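(* Let $\mathcal N,\mathcal M\ge 0$ be integers and let $F:[-1,1]\times\mathbb R\to\mathbb R$ be a linear combination $$F(x,y)=\sum_{i=1}^{\mathcal N}a_i f_i(x)+\sum_{j=1}^{\mathcal M}b_j g_j(y),\qquad f_i\in\mathcal F_{\mathrm{all}},\ g_j\in\mathcal G_{\mathrm{all}},\ a_i,b_j\in\mathbb R,$$ where $\mathcal N$ and $\mathcal M$ are regarded as constants. Let $h_j(z)$, $z=e^{\mathrm i y}$, denote the Laurent polynomial representation of $g_j(y)$, and let the degree of $F$ be the tuple $(n_l,m_l)$ with $$n_l=\max_{1\le i\le\mathcal N}\deg(f_i),\qquad m_l=\max_{1\le j\le\mathcal M}\deg(h_j).$$ Suppose that, for a constant $\mathcal C$, $$\sum_{i=1}^{\mathcal N}|a_i|+\sum_{j=1}^{\mathcal M}|b_j|=\mathcal C .$$ Then, for any $\delta\in(0,\delta_0]$ (with $\delta_0\in(0,1/2]$ an absolute constant), $F$ can be $\delta$-approximated by a polynomial of degree $$\Bigl(O\bigl(\sqrt{n_l\ln(1/\delta)}\bigr),\ O\bigl(\sqrt{m_l\ln(1/\delta)}\bigr)\Bigr).$$ That is, there are a polynomial $P(x)$ of degree $O(\sqrt{n_l\ln(1/\delta)})$ and a Laurent polynomial $L(z)$ of degree $O(\sqrt{m_l\ln(1/\delta)})$ such that $$\sup_{x\in[-1,1],\,y\in\mathbb R}\bigl|F(x,y)-\bigl(P(x)+L(e^{\mathrm i y})\bigr)\bigr|\le\delta .$$ The constants implied by $O(\cdot)$ depend only on $\mathcal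 N,\mathcal M,\mathcal C$ (not on the functions $f_i,g_j$, on their parameters $n,\beta,\gamma,\lambda$, or on $\delta$).
   Context: Function classes. On $x\in[-1,1]$: $\mathcal F_{\mathrm{mon}}=\{x^n: n\in\mathbb N\}$, $\mathcal F_{\mathrm{exp}}=\{e^{-\beta(1+x)}:\beta>0\}$, $\mathcal F_{\mathrm{gauss}}=\{e^{-(\gamma x)^2}:\gamma\ge0\}$, $\mathcal F_{\mathrm{erf}}=\{\operatorname{erf}(\lambda x):\lambda>0\}$, where $\operatorname{erf}(\lambda x)=\frac{2\lambda}{\sqrt\pi}\int_0^x e^{-(\lambda u)^2}\,du$. Set $\mathcal F_{\mathrm{all}}=\mathcal F_{\mathrm{mon}}\cup\mathcal F_{\mathrm{exp}}\cup\mathcal F_{\mathrm{gauss}}\cup\mathcal F_{\mathrm{erf}}$. For each class $\mathcal F_i$, let $\mathcal F_i^{(\cos)}$ and $\mathcal F_i^{(\sin)}$ be the sets of functions of $y\in\mathbb R$ obtained by substituting $x=\cos y$ and $x=\sin y$, respectively, in the elements of $\mathcal F_i$ (e.g. $\mathcal F_{\mathrm{mon}}^{(\cos)}=\{\cos^n y:n\in\mathbb N\}$). Set $\mathcal G_{\mathrm{all}}=\bigcup_{i\in\{\mathrm{mon},\mathrm{exp},\mathrm{gauss},\mathrm{erf}\}}\bigl(\mathcal F_i^{(\cos)}\cup\mathcal F_i^{(\sin)}\bigr)$. Laurent polynomials. A Laurent polynomial of degree $l$ is $\sum_{k=-l}^{l}c_kz^k$ (with complex coefficients, $c_{\pm l}\ne0$),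 evaluated at $z=e^{\mathrm i y}$. The Laurent polynomial representation $h_j(z)$ of $g_j(y)$ is $g_j$ rewritten in the variable $z=e^{\mathrm i y}$, so $g_j(y)=h_j(e^{\mathrm i y})$ (for non-monomial classes, via its series truncated at the truncation degree below). Degrees of the functions. $\deg$ denotes the degree for monomials and the (Maclaurin) truncation degree at accuracy $\delta$ for the other functions: $\deg(x^n)=n$; $\deg(e^{-\beta(1+x)})=t_\beta$, of order $\beta+\ln(1/\delta)$; $\deg(e^{-(\gamma x)^2})=t_\gamma$, of order $\gamma^2+\ln(1/\delta)$; $\deg(\operatorname{erf}(\lambda x))=t_\lambda$, of order $\lambda^2+\ln(1/\delta)$. The $h_j$ corresponding to the cosine or sine version of a function has the same degree as that function. Because conclusions are up to $O(\cdot)$, one may take $t_\beta=\beta+\ln(1/\delta)$, $t_\gamma=\gamma^2+\ln(1/\delta)$, $t_\lambda=\lambda^2+\ln(1/\delta)$. For a function that is a sum of a degree-$d_1$ polynomial in $x$ and a degree-$d_2$ Laurent polynomial in $z$, its degree is the tuple $(d_1,d_2)$. ''Degree $O(\cdot)$'' means degree at most the indicated quantity times a constant. ''$\delta$-approximated'' means uniform error at most $\delta$ over $(x,y)\in[-1,1]\times\mathbb R$. Conventions: an empty maximum or empty sum is $0$. *)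

(* Defs.v *)
(* MathComp-Analysis; complex numbers are R[i] from mathcomp-real-closed. *)
From HB Require Import structures.
From mathcomp Require Import all_boot all_order all_algebra.
From mathcomp Require Import complex.
From mathcomp Require Import all_classical all_reals all_analysis.
Set Implicit Arguments.
Unset Strict Implicit.
Unset Printing Implicit Defensive.
Import Order.TTheory GRing.Theory Num.Theory.
Import numFieldNormedType.Exports.
Local Open Scope classical_set_scope.
Local Open Scope ring_scope.
Local Open Scope complex_scope.

(* The library integrates over sets, so the integral from a to b must be
   oriented by hand when b < a. *)
Definition oriented_int (R : realType) (a b : R) (h : R -> R) : R :=
  if a <= b then \int[@lebesgue_measure R]_(u in `[a, b]) h u
  else - \int[@lebesgue_measure R]_(u in `[b, a]) h u.

Definition mon_fun (R : realType) (n : nat) (x : R) : R := x ^+ n.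

Definition exp_fun (R : realType) (beta x : R) : R := expR (- beta * (1 + x)).

Definition gaussian_fun (R : realType) (gamma x : R) : R :=
  expR (- (gamma * x) ^+ 2).

(* x |-> erf (lambda * x) *)
Definition erf_fun (R : realType) (lambda x : R) : R :=
  2 * lambda / Num.sqrt pi
  * oriented_int 0 x (fun u => expR (- (lambda * u) ^+ 2)).

(* Functions on [-1, 1] are represented by total functions on R whose values
   off [-1, 1] are irrelevant. *)
Definition eq_on_I (R : realType) (f h : R -> R) : Prop :=
  {in `[-1, 1]%R, f =1 h}.

Definition F_mon (R : realType) : set (R -> R) :=
  [set f | exists n : nat, eq_on_I f (mon_fun n)].

Definition F_exp (R : realType) : set (R -> R) :=
  [set f | exists2 beta : R, 0 < beta & eq_on_I f (exp_fun beta)].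

Definition F_gauss (R : realType) : set (R -> R) :=
  [set f | exists2 gamma : R, 0 <= gamma & eq_on_I f (gaussian_fun gamma)].

Definition F_erf (R : realType) : set (R -> R) :=
  [set f | exists2 lambda : R, 0 < lambda & eq_on_I f (erf_fun lambda)].

Definition F_all (R : realType) : set (R -> R) :=
  @F_mon R `|` @F_exp R `|` @F_gauss R `|` @F_erf R.

Definition cos_subst (R : realType) (A : set (R -> R)) : set (R -> R) :=
  [set f \o cos | f in A].

Definition sin_subst (R : realType) (A : set (R -> R)) : set (R -> R) :=
  [set f \o sin | f in A].

Definition G_all (R : realType) : set (R -> R) :=
  (cos_subst (@F_mon R) `|` sin_subst (@F_mon R))
  `|` (cos_subst (@F_exp R) `|` sin_subst (@F_exp R))
  `|` (cos_subst (@F_gauss R) `|` sin_subst (@F_gauss R))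
  `|` (cos_subst (@F_erf R) `|` sin_subst (@F_erf R)).

(* [is_deg delta f d]: d is the degree of f if f is a monomial, and the
   Maclaurin truncation degree of f at accuracy delta otherwise; the truncation
   degrees, only meaningful up to constant factors, are normalized to the real
   numbers beta + ln (1/delta), gamma^2 + ln (1/delta), lambda^2 + ln (1/delta).
   This is a relation because the constant 1 is both the monomial x^0 and the
   Gaussian with gamma = 0; it may be read with either degree. *)
Definition is_deg (R : realType) (delta : R) (f : R -> R) (d : R) : Prop :=
  [\/ exists2 n : nat, eq_on_I f (mon_fun n) & d = n%:R,
      exists beta : R,
        [/\ 0 < beta, eq_on_I f (exp_fun beta) & d = beta + ln (1 / delta)],
      exists gamma : R,
        [/\ 0 <= gamma, eq_on_I f (gaussian_fun gamma)
          & d = gamma ^+ 2 + ln (1 / delta)]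
    | exists lambda : R,
        [/\ 0 < lambda, eq_on_I f (erf_fun lambda)
          & d = lambda ^+ 2 + ln (1 / delta)]].

(* Degree of the Laurent polynomial h representing g in the variable
   z = exp(iy): if g(y) is f(cos y) or f(sin y), then h is f (truncated at its
   truncation degree when f is not a monomial) at x = (z + 1/z)/2 or
   x = (z - 1/z)/(2i), and its degree is by convention that of f. *)
Definition is_laurent_rep_deg (R : realType) (delta : R) (g : R -> R) (d : R) :
    Prop :=
  exists2 f : R -> R, is_deg delta f d & g = f \o cos \/ g = f \o sin.

(* sum_(k = -l)^l c_k z^k *)
Definition laurent_eval (R : realType) (l : nat) (c : int -> R[i]) (z : R[i]) :
    R[i] :=
  \sum_(k < l.*2.+1) c (k%:Z - l%:Z) * z ^ (k%:Z - l%:Z).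

(* The expression sum_(k = -l)^l c_k z^k has degree exactly l; constants,
   including 0, have degree 0. *)
Definition laurent_degree (R : realType) (l : nat) (c : int -> R[i]) : Prop :=
  l = 0%N \/ (c l%:Z != 0 /\ c (- l%:Z) != 0).

Definition expi (R : realType) (y : R) : R[i] := cos y +i* sin y.

(* Main.v *)
Require Import Defs.
From HB Require Import structures.
From mathcomp Require Import all_boot all_order all_algebra.
From mathcomp Require Import complex ring lra zify.
From mathcomp Require Import all_classical all_reals all_analysis.
Set Implicit Arguments.
Unset Strict Implicit.
Unset Printing Implicit Defensive.
Import Order.TTheory GRing.Theory Num.Theory.
Import numFieldNormedType.Exports.
Local Open Scope classical_set_scope.
Local Open Scope ring_scope.
Local Open Scope complex_scope.

(* Expand each function in Chebyshev polynomials T_k and weight the coefficient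
   of T_k by cosh (s k): these weights are multiplicative, so x^n has weighted
   norm (cosh s)^n and exp (- b (1 + T_m)) at most exp (b (cosh (s m) - 1)).
   Dropping all k > d costs at most 2 e^(-s d) times the weighted norm; with D
   the degree of the function, L = ln (1/delta), s = sqrt (L/D) and d a large
   multiple of sqrt (D L), the norm is e^O(L) while e^(-s d) beats any fixed
   power of delta.  A Gaussian is the case m = 2, since x^2 = (1 + T_2) / 2, and
   erf is its primitive: integrating T_k gains a factor 1/k, which absorbs the
   prefactor lambda = O(d).  Finally a polynomial in cos y or sin y is a Laurent
   polynomial of the same degree in e^(iy). *)

(** * Chebyshev polynomials of both kinds *)

(** Both kinds obey one recurrence and differ only in their first two terms; the lock keeps the
    iteration from unfolding. *)
HB.lock Definition cheb_rec (R : comNzRingType) (p q : {poly R})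
    (n : nat) : {poly R} :=
  (iter n (fun u => (u.2, 2 * 'X * u.2 - u.1)) (p, q)).1.

Lemma cheb_rec0 (R : comNzRingType) (p q : {poly R}) : cheb_rec p q 0 = p.
Proof. by rewrite cheb_rec.unlock. Qed.

Lemma cheb_rec1 (R : comNzRingType) (p q : {poly R}) : cheb_rec p q 1 = q.
Proof. by rewrite cheb_rec.unlock. Qed.

Lemma cheb_recSS (R : comNzRingType) (p q : {poly R}) (n : nat) :
  cheb_rec p q n.+2 = 2 * 'X * cheb_rec p q n.+1 - cheb_rec p q n.
Proof. by rewrite cheb_rec.unlock. Qed.

Definition chebT (R : comNzRingType) : nat -> {poly R} := cheb_rec 1 'X.

(* Shifted by one: [chebU n] is the polynomial U_(n-1) of degree n - 1. *)
Definition chebU (R : comNzRingType) : nat -> {poly R} := cheb_rec 0 1.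

Lemma nat_ind2 (P : nat -> Prop) :
  P 0%N -> P 1%N -> (forall n, P n -> P n.+1 -> P n.+2) -> forall n, P n.
Proof.
move=> P0 P1 PS n; suff [] : P n /\ P n.+1 by [].
by elim: n => [|n [IH1 IH2]]; split=> //; apply: PS.
Qed.

Section Chebyshev.
Variable R : comNzRingType.
Notation T := (@chebT R).
Notation U := (@chebU R).

Lemma chebTE n : T n.+1 = 'X * U n.+1 - U n.
Proof.
rewrite /chebT /chebU; elim/nat_ind2: n => [||n IH1 IH2].
- by rewrite !cheb_rec1 cheb_rec0; ring.
- by rewrite !cheb_recSS !cheb_rec1 !cheb_rec0; ring.
- by rewrite cheb_recSS IH1 IH2 !(cheb_recSS _ _ n.+1) (cheb_recSS _ _ n); ring.
Qed.

(** Together with [deriv_chebT] this makes T_(n+1), for n > 0, a difference of derivatives, ready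
    for integration. *)
Lemma chebU_sub n : U n.+2 - U n = 2 * T n.+1.
Proof. by rewrite chebTE /chebU cheb_recSS; ring. Qed.

Lemma deriv_chebT n : (T n)^`() = n%:R * U n.
Proof.
elim/nat_ind2: n => [||n IH1 IH2].
- by rewrite /chebT cheb_rec0 derivC mul0r.
- by rewrite /chebT /chebU !cheb_rec1 derivX mul1r.
- rewrite /chebT cheb_recSS -/(T n.+1) -/(T n) -[2]polyC_natr.
  rewrite derivB !derivM derivX derivC IH1 IH2.
  rewrite chebTE /chebU cheb_recSS polyC_natr -/(U n.+1) -/(U n).
  by rewrite -[n.+2]addn2 -[n.+1]addn1 !natrD; ring.
Qed.

Lemma size_chebT n : (size (T n) <= n.+1)%N.
Proof.
elim/nat_ind2: n => [||n IH1 IH2]; first by rewrite /chebT cheb_rec0 size_poly1.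
  by rewrite /chebT cheb_rec1 size_polyX.
rewrite /chebT cheb_recSS; apply: leq_trans (size_polyD _ _) _.
rewrite geq_max size_polyN; apply/andP; split; last first.
  by apply: leq_trans IH1 _; rewrite -addn2 leq_addr.
rewrite mulrAC; apply: leq_trans (size_polyMleq _ _) _; rewrite size_polyX.
rewrite addn2 /= ltnS -polyC_natr mul_polyC.
exact: leq_trans (size_scale_leq _ _) _.
Qed.

End Chebyshev.

(** * Chebyshev polynomials as cosines on [-1, 1] *)

Section ChebyshevReal.
Variable R : realType.
Notation T := (@chebT R).

Lemma chebT_cos n (t : R) : (T n).[cos t] = cos (n%:R * t).
Proof.
elim/nat_ind2: n => [||n IH1 IH2].
- by rewrite /chebT cheb_rec0 hornerC mul0r cos0.
- by rewrite /chebT cheb_rec1 hornerX mul1r.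
- rewrite /chebT cheb_recSS -/(T n.+1) -/(T n) !hornerE IH1 IH2.
  have -> : n.+2%:R * t = n.+1%:R * t + t by rewrite -[n.+2]addn1 natrD; ring.
  have -> : n%:R * t = n.+1%:R * t - t by rewrite -[n.+1]addn1 natrD; ring.
  by rewrite cosB cosD; ring.
Qed.

Lemma chebT_acos n (x : R) : -1 <= x <= 1 -> (T n).[x] = cos (n%:R * acos x).
Proof. by move=> hx; rewrite -chebT_cos (acos_def hx).2. Qed.

Lemma norm_chebT n (x : R) : -1 <= x <= 1 -> `|(T n).[x]| <= 1.
Proof. by move=> hx; rewrite chebT_acos// ler_norml cos_geN1 cos_le1. Qed.

(** The product-to-sum formula for cosines at [acos x]. Subtraction on [nat] truncates, so
    [(m - k) + (k - m)] is the distance |m - k|. *)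
Lemma chebTM m k (x : R) : -1 <= x <= 1 ->
  (T m).[x] * (T k).[x] =
    2^-1 * (T (m + k)).[x] + 2^-1 * (T ((m - k) + (k - m))%N).[x].
Proof.
move=> hx; rewrite !chebT_acos//; set t := acos x.
have -> : cos (((m - k) + (k - m))%:R * t) = cos (m%:R * t - k%:R * t).
  have [km|/ltnW mk] := leqP k m.
    by rewrite (eqP km) addn0 natrB // mulrBl.
  by rewrite (eqP mk) add0n natrB // mulrBl -cosN opprB.
by rewrite natrD mulrDl cosB cosD; field.
Qed.

Lemma chebT2 (x : R) : (T 2).[x] = 2 * x ^+ 2 - 1.
Proof. by rewrite /chebT cheb_recSS cheb_rec1 cheb_rec0 !hornerE. Qed.

(* T_(m+2) is the derivative of T_(m+3) / (2(m+3)) - T_(m+1) / (2(m+1)):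
   integration gains a factor 1/k on T_k. *)
Lemma chebT_primitive k : exists A : {poly R},
  [/\ A^`() = T k, A.[0] = 0, (size A <= k.+2)%N &
    forall (d : nat) (x : R), (0 < d < k)%N -> -1 <= x <= 1 ->
      `|A.[x]| <= 2 / d%:R].
Proof.
(* For k = 0 and k = 1 no d satisfies 0 < d < k, so the bound is vacuous there. *)
case: k => [|[|m]].
- exists 'X; split; rewrite ?derivX ?hornerX ?size_polyX /chebT ?cheb_rec0//.
  move=> d x.
  by rewrite ltn0 andbF.
- exists (2^-1 *: 'X^2); split => [|||d x].
  + rewrite derivZ derivXn /= expr1 /chebT cheb_rec1.
    rewrite -(scaler_nat 2 ('X : {poly R})) scalerA.
    by rewrite mulVf ?scale1r ?pnatr_eq0.
  + by rewrite hornerZ hornerXn expr0n mulr0.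
  + by rewrite (leq_trans (size_scale_leq _ _))// size_polyXn.
  + by case: d.
pose B : {poly R} := (2 * m.+3%:R)^-1 *: T m.+3 - (2 * m.+1%:R)^-1 *: T m.+1.
have B1 x : -1 <= x <= 1 -> `|B.[x]| <= m.+1%:R^-1.
  move=> hx; rewrite /B !hornerE; apply: le_trans (ler_normB _ _) _.
  have uv : (2 * m.+3%:R)^-1 <= (2 * m.+1%:R)^-1 :> R.
    by rewrite lef_pV2 ?posrE ?mulr_gt0// ler_pM2l// ler_nat; lia.
  have u0 : 0 <= (2 * m.+3%:R)^-1 :> R by rewrite invr_ge0.
  have v0 := le_trans u0 uv.
  have -> : m.+1%:R^-1 = (2 * m.+1%:R)^-1 + (2 * m.+1%:R)^-1 :> R.
    by rewrite invfM; move: (m.+1%:R^-1) => z; field.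
  rewrite !normrM (ger0_norm u0) (ger0_norm v0).
  apply: lerD; last by rewrite ler_piMr ?norm_chebT.
  by apply: le_trans uv; rewrite ler_piMr ?norm_chebT.
(* Normalizing the value at 0 at most doubles the bound on [B], whence the 2; and d < m + 2 gives
   1/(m+1) <= 1/d. *)
exists (B - B.[0]%:P); split => [|||d x /andP[d0 dm] hx].
- rewrite derivB derivC subr0 /B derivB !derivZ !deriv_chebT.
  have e (n : nat) (p : {poly R}) :
      (2 * n.+1%:R)^-1 *: (n.+1%:R * p) = 2^-1 *: p.
    rewrite -polyC_natr mul_polyC scalerA invfM -mulrA mulVf ?mulr1//.
  rewrite !e -scalerBr chebU_sub -polyC_natr mul_polyC scalerA mulVf ?scale1r//.
- by rewrite !hornerE subrr.
- have sT n a : (size (a *: T n) <= n.+1)%N.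
    by rewrite (leq_trans (size_scale_leq _ _))// size_chebT.
  apply: leq_trans (size_polyD _ _) _; rewrite geq_max size_polyN.
  rewrite (leq_trans (size_polyC_leq1 _)) ?andbT//.
  apply: leq_trans (size_polyD _ _) _; rewrite geq_max size_polyN.
  by rewrite sT (leq_trans (sT _ _))//; lia.
- rewrite hornerD hornerN hornerC; apply: le_trans (ler_normB _ _) _.
  have dm' : m.+1%:R^-1 <= d%:R^-1 :> R.
    by rewrite lef_pV2 ?posrE ?ltr0n// ler_nat; lia.
  have -> : 2 / d%:R = d%:R^-1 + d%:R^-1 :> R by rewrite mulr_natl mulr2n.
  by apply: lerD; apply: le_trans dm'; apply: B1 => //; lra.
Qed.

End ChebyshevReal.

(** * Weighted norms of Chebyshev expansions and their truncation *)

Section ChebyshevWeights.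
Variable R : realType.
Notation T := (@chebT R).

Definition cosh (s : R) : R := (expR s + expR (- s)) / 2.

Lemma cosh_ge0 s : 0 <= cosh s.
Proof. by rewrite divr_ge0// addr_ge0// expR_ge0. Qed.

Lemma coshN s : cosh (- s) = cosh s.
Proof. by rewrite /cosh opprK addrC. Qed.

Lemma cosh0 : cosh 0 = 1.
Proof. by rewrite /cosh oppr0 expR0; field. Qed.

Lemma coshM a b : cosh a * cosh b = 2^-1 * cosh (a + b) + 2^-1 * cosh (a - b).
Proof. by rewrite /cosh !opprD !opprK !expRD; field. Qed.

(** The exact counterpart of [chebTM]: cosh obeys the same product formula as cos, which is what
    makes the weights multiplicative. *)
Lemma coshM_nat s m k : cosh (s * m%:R) * cosh (s * k%:R) =
  2^-1 * cosh (s * (m + k)%:R) + 2^-1 * cosh (s * ((m - k) + (k - m))%:R).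
Proof.
have -> : cosh (s * ((m - k) + (k - m))%:R) = cosh (s * m%:R - s * k%:R).
  have [km|/ltnW mk] := leqP k m.
    by rewrite (eqP km) addn0 natrB // mulrBr.
  by rewrite (eqP mk) add0n natrB // mulrBr -coshN opprB.
by rewrite natrD mulrDr coshM.
Qed.

Lemma expR_half_le_ch s : expR s / 2 <= cosh s.
Proof. by rewrite ler_pM2r ?invr_gt0// lerDl expR_ge0. Qed.

(** From cosh s - 1 = (e^s - 1)^2 / (2 e^s), e^s - 1 <= s e^s and e^s <= 16. The range extends to 2
    because the argument will be s m with s <= 1 and m <= 2. *)
Lemma cosh_le s : 0 <= s <= 2 -> cosh s - 1 <= 8 * s ^+ 2.
Proof.
move=> /andP[s0 s2].
have e2 : expR s <= 16.
  have h : 2^-1 <= expR (- 2^-1) :> R.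
    by apply: le_trans (expR_ge1Dx _); lra.
  have -> : expR s = expR (s / 4) ^+ 4.
    by rewrite -expRM_natl; congr expR; field.
  have : expR (s / 4) <= 2.
    have : expR (s / 4) <= expR 2^-1 by rewrite ler_expR; lra.
    have -> : expR 2^-1 = (expR (- 2^-1))^-1 :> R by rewrite expRN invrK.
    by move=> /le_trans; apply; rewrite invf_ple ?posrE ?expR_gt0.
  move=> h2; apply: (@le_trans _ _ (2 ^+ 4)); last by lra.
  by rewrite lerXn2r ?nnegrE ?expR_ge0.
have e3 : expR s - 1 <= s * expR s.
  have := expR_ge1Dx (- s); have := expR_gt0 s => e0.
  rewrite expRN => h.
  have : (1 - s) * expR s <= 1 by rewrite -ler_pdivlMr// div1r.
  by lra.
have e1 : 0 <= expR s - 1 by rewrite subr_ge0 -expR0 ler_expR.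
have -> : cosh s - 1 = (expR s - 1) ^+ 2 / (2 * expR s).
  by rewrite /cosh expRN; field; rewrite expR_eq0.
rewrite ler_pdivrMr ?mulr_gt0 ?expR_gt0//.
have h : (expR s - 1) ^+ 2 <= (s * expR s) ^+ 2.
  by rewrite lerXn2r ?nnegrE// mulr_ge0 ?expR_ge0.
apply: le_trans h _; rewrite exprMn.
have : 0 <= s ^+ 2 * expR s * (16 - expR s).
  by rewrite !mulr_ge0 ?sqr_ge0 ?expR_ge0 ?subr_ge0.
by nra.
Qed.

(** Pairs of a coefficient and an index; indices may repeat, so sums and products are formed by
    concatenation without collecting terms. *)
Definition cheb_sum (r : seq (R * nat)) (x : R) : R :=
  \sum_(u <- r) u.1 * (T u.2).[x].

(* The weights cosh (s k) multiply exactly as the T_k do, so that the weighted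
   norm below is submultiplicative. *)
Definition cheb_weight (s : R) (r : seq (R * nat)) : R :=
  \sum_(u <- r) `|u.1| * cosh (s * u.2%:R).

Definition cheb_bounded (s : R) (h : R -> R) (w : R) : Prop :=
  exists2 r, forall x, -1 <= x <= 1 -> h x = cheb_sum r x &
    cheb_weight s r <= w.

Lemma cheb_boundedW s h w w' :
  w <= w' -> cheb_bounded s h w -> cheb_bounded s h w'.
Proof. by move=> ww [r hr rw]; exists r => //; apply: le_trans ww. Qed.

Lemma cheb_bounded1 s : cheb_bounded s (fun=> 1) 1.
Proof.
exists [:: (1, 0%N)] => [x hx|]; rewrite /cheb_sum /cheb_weight big_seq1/=.
  by rewrite /chebT cheb_rec0 hornerC mul1r.
by rewrite normr1 mul1r mulr0 cosh0.
Qed.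

Lemma cheb_bounded0 s : cheb_bounded s (fun=> 0) 0.
Proof.
by exists [::] => [x hx|]; rewrite /cheb_sum /cheb_weight big_nil.
Qed.

Lemma cheb_boundedD s h1 h2 w1 w2 : cheb_bounded s h1 w1 ->
  cheb_bounded s h2 w2 -> cheb_bounded s (fun x => h1 x + h2 x) (w1 + w2).
Proof.
move=> [r1 e1 b1] [r2 e2 b2]; exists (r1 ++ r2) => [x hx|].
  by rewrite /cheb_sum big_cat /= e1 ?e2.
by rewrite /cheb_weight big_cat lerD.
Qed.

Lemma cheb_boundedZ s a h w :
  cheb_bounded s h w -> cheb_bounded s (fun x => a * h x) (`|a| * w).
Proof.
move=> [r e b]; exists [seq (a * u.1, u.2) | u <- r] => [x hx|].
  rewrite /cheb_sum big_map e// mulr_sumr; apply: eq_bigr => u _ /=.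
  by rewrite mulrA.
rewrite /cheb_weight big_map /= -[X in X <= _](_ : `|a| * cheb_weight s r = _).
  by rewrite ler_wpM2l.
by rewrite mulr_sumr; apply: eq_bigr => u _; rewrite normrM mulrA.
Qed.

(** Each term splits into two halves by [chebTM], and by [coshM_nat] their weights add up to exactly
    cosh (s m) times the old weight. *)
Lemma cheb_boundedM s m h w : cheb_bounded s h w ->
  cheb_bounded s (fun x => (T m).[x] * h x) (cosh (s * m%:R) * w).
Proof.
move=> [r e b]; exists ([seq (2^-1 * u.1, (m + u.2)%N) | u <- r] ++
  [seq (2^-1 * u.1, (m - u.2 + (u.2 - m))%N) | u <- r]) => [x hx|].
  rewrite /cheb_sum big_cat/= !big_map e// mulr_sumr -big_split /=.
  apply: eq_bigr => u _; rewrite mulrCA chebTM//.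
  by rewrite mulrDr !mulrA ![u.1 * _]mulrC.
rewrite /cheb_weight big_cat/= !big_map -big_split/=.
apply: le_trans (ler_wpM2l (cosh_ge0 _) b).
rewrite mulr_sumr le_eqVlt; apply/orP; left; apply/eqP/esym.
apply: eq_bigr => u _; rewrite mulrCA coshM_nat !normrM.
rewrite [`|2^-1|]ger0_norm ?invr_ge0//.
by rewrite mulrDr !mulrA ![`|u.1| * _]mulrC.
Qed.

Lemma cheb_boundedX s m n :
  cheb_bounded s (fun x => (T m).[x] ^+ n) (cosh (s * m%:R) ^+ n).
Proof.
elim: n => [|n IH]; first exact: cheb_bounded1.
have [r e b] := cheb_boundedM m IH.
by exists r => [x hx|]; rewrite exprS// e.
Qed.

Lemma cheb_bounded_sum s n (a : nat -> R) (h : nat -> R -> R) (w : nat -> R) :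
  (forall j, cheb_bounded s (h j) (w j)) ->
  cheb_bounded s (fun x => \sum_(j < n) a j * h j x)
    (\sum_(j < n) `|a j| * w j).
Proof.
move=> hw; elim: n => [|n IH].
  by rewrite big_ord0; have [r e b] := cheb_bounded0 s;
    exists r => // x hx; rewrite big_ord0; exact: e.
have [r e b] := cheb_boundedD IH (cheb_boundedZ (a n) (hw n)).
by exists r => [x hx|]; rewrite big_ord_recr //= -e.
Qed.

(** A Markov-type bound: for k > d the weight cosh (s k) is at least e^(s d) / 2. *)
Lemma cheb_tail s (d : nat) r : 0 <= s ->
  \sum_(u <- r | (d < u.2)%N) `|u.1| <=
    2 * cheb_weight s r * expR (- (s * d%:R)).
Proof.
move=> s0; rewrite /cheb_weight mulr_sumr mulr_suml big_mkcond.
apply: ler_sum => u _; case: ifP => [du|_]; last first.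
  by rewrite !mulr_ge0 ?cosh_ge0 ?expR_ge0.
rewrite -mulrA mulrCA -[X in X <= _]mulr1 -mulrA.
apply: ler_wpM2l => //; rewrite expRN mulrA.
rewrite ler_pdivlMr ?expR_gt0// mul1r -ler_pdivrMr//.
apply: le_trans (expR_half_le_ch _); rewrite ler_pM2r ?invr_gt0//.
by rewrite ler_expR ler_wpM2l// ler_nat ltnW.
Qed.

(** Since |T_k| <= 1 on [-1, 1], dropping terms costs at most the sum of the moduli of their
    coefficients, which [cheb_tail] controls. *)
Lemma cheb_truncation s h w (d : nat) : 0 <= s -> cheb_bounded s h w ->
  exists2 p : {poly R}, (size p <= d.+1)%N &
    forall x, -1 <= x <= 1 -> `|h x - p.[x]| <= 2 * w * expR (- (s * d%:R)).
Proof.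
move=> s0 [r e b]; exists (\sum_(u <- r | (u.2 <= d)%N) u.1 *: T u.2).
  apply: leq_trans (size_sum _ _ _) _; rewrite big_tnth.
  apply/bigmax_leqP => i; move: (tnth _ _) => u ud.
  by rewrite (leq_trans (size_scale_leq _ _))// (leq_trans (size_chebT _ _)).
move=> x hx; rewrite e// horner_sum /cheb_sum (bigID (fun u => (u.2 <= d)%N))/=.
under [X in _ + _ - X]eq_bigr do rewrite hornerZ.
rewrite addrAC subrr add0r; apply: le_trans (ler_norm_sum _ _ _) _.
apply: (@le_trans _ _ (\sum_(u <- r | (d < u.2)%N) `|u.1|)).
  under eq_bigl do rewrite -ltnNge.
  by apply: ler_sum => u _; rewrite normrM ler_piMr ?norm_chebT.
apply: le_trans (cheb_tail d r s0) _.
by rewrite ler_wpM2r ?expR_ge0// ler_wpM2l.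
Qed.

(** * The exponential series *)

Lemma expR_taylor_cvg (z : R) :
  (fun n => \sum_(j < n) j`!%:R^-1 * z ^+ j) @ \oo --> expR z.
Proof.
have := @is_cvg_series_exp_coeff R z; rewrite /expR => h.
suff -> : (fun n => \sum_(j < n) j`!%:R^-1 * z ^+ j) = series (exp_coeff z).
  by [].
apply/funext => n; rewrite /series /= big_mkord; apply: eq_bigr => j _.
by rewrite exp_coeffE.
Qed.

Lemma expR_taylor_le (z : R) n : 0 <= z ->
  \sum_(j < n) j`!%:R^-1 * z ^+ j <= expR z.
Proof.
move=> z0; rewrite -(cvg_lim (@Rhausdorff R) (@expR_taylor_cvg z)).
apply: nondecreasing_cvgn_le (n); last first.
  by apply/cvg_ex; eexists; apply: expR_taylor_cvg.
apply/nondecreasing_seqP => k; rewrite big_ord_recr /= lerDl.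
by rewrite mulr_ge0 ?invr_ge0 ?exprn_ge0.
Qed.

(** The remainder at z is dominated term by term by the remainder at b; this is shown for partial
    sums and passed to the limit. *)
Lemma expR_taylor_error (z b : R) n : `|z| <= b ->
  `|expR z - \sum_(j < n) j`!%:R^-1 * z ^+ j| <=
    expR b - \sum_(j < n) j`!%:R^-1 * b ^+ j.
Proof.
move=> zb; have b0 : 0 <= b by apply: le_trans zb.
have cz := @expR_taylor_cvg z.
have c1 : (fun k => `|\sum_(j < k) j`!%:R^-1 * z ^+ j -
    \sum_(j < n) j`!%:R^-1 * z ^+ j|) @ \oo -->
    `|expR z - \sum_(j < n) j`!%:R^-1 * z ^+ j|.
  by apply: cvg_norm; apply: cvgB => //; apply: cvg_cst.
rewrite -(cvg_lim (@Rhausdorff R) c1); apply: limr_le.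
  by apply/cvg_ex; eexists; exact: c1.
exists n => // k /= nk.
rewrite -!(big_mkord xpredT (fun j => j`!%:R^-1 * _ ^+ j)).
rewrite (big_cat_nat _ nk)//= addrAC subrr add0r.
apply: le_trans (ler_norm_sum _ _ _) _; rewrite lerBrDr.
apply: le_trans (expR_taylor_le k b0).
rewrite -!(big_mkord xpredT (fun j => j`!%:R^-1 * b ^+ j)).
rewrite [leRHS](big_cat_nat _ nk)//= [leLHS]addrC lerD2l.
apply: ler_sum => j _; rewrite normrM ger0_norm ?invr_ge0// normrX.
by rewrite ler_wpM2l ?invr_ge0// lerXn2r ?nnegrE.
Qed.

(* The Maclaurin polynomial may be taken arbitrarily long: its weighted norm
   stays bounded by that of the exponential series. *)
Lemma cheb_bounded_exp s b m (eps : R) : 0 <= b -> 0 < eps ->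
  exists2 h, cheb_bounded s h (expR (b * (cosh (s * m%:R) - 1))) &
    forall x, -1 <= x <= 1 -> `|expR (- b * (1 + (T m).[x])) - h x| <= eps.
Proof.
move=> b0 e0.
(* The length is fixed by convergence at b alone; as |b T_m(x)| <= b, it then serves every x in
   [-1, 1]. *)
have [n hn] : exists n, expR b - \sum_(j < n) j`!%:R^-1 * b ^+ j <= eps.
  have /cvgrPdist_le/(_ _ e0) [n _ h] := @expR_taylor_cvg b.
  by exists n; apply: le_trans (ler_norm _) (h n _); rewrite /=.
pose a j := expR (- b) * (j`!%:R^-1 * (- b) ^+ j).
exists (fun x => \sum_(j < n) a j * (T m).[x] ^+ j).
  apply: cheb_boundedW (cheb_bounded_sum n a (cheb_boundedX s m)) => /=.
  rewrite mulrBr mulr1 expRD [leRHS]mulrC.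
  have -> : \sum_(j < n) `|a j| * cosh (s * m%:R) ^+ j =
      expR (- b) * \sum_(j < n) j`!%:R^-1 * (b * cosh (s * m%:R)) ^+ j.
    rewrite mulr_sumr; apply: eq_bigr => j _; rewrite /a !normrM normrX normrN.
    rewrite !ger0_norm ?invr_ge0 ?expR_ge0//.
    by rewrite [(b * _) ^+ _]exprMn !mulrA.
  by rewrite ler_wpM2l ?expR_ge0// expR_taylor_le// mulr_ge0// cosh_ge0.
move=> x hx; set t := (T m).[x].
have -> : \sum_(j < n) a j * t ^+ j =
    expR (- b) * \sum_(j < n) j`!%:R^-1 * (- b * t) ^+ j.
  by rewrite mulr_sumr; apply: eq_bigr => j _; rewrite /a exprMn !mulrA.
rewrite mulrDr mulr1 expRD -mulrBr normrM ger0_norm ?expR_ge0//.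
apply: le_trans hn.
set e := expR b - _; rewrite -[e]mul1r; apply: ler_pM; rewrite ?expR_ge0//.
  by rewrite -[leRHS]expR0 ler_expR oppr_le0.
apply: expR_taylor_error; rewrite normrM normrN (ger0_norm b0).
by rewrite ler_piMr// norm_chebT.
Qed.

End ChebyshevWeights.

(** * Integrating a uniform polynomial approximation *)

Section PolynomialIntegral.
Variable R : realType.
Let mu := @lebesgue_measure R.

Lemma continuous_integrable_itv (a b : R) (h : R -> R) :
  continuous h -> mu.-integrable `[a, b] (EFin \o h).
Proof.
move=> ch; apply: continuous_compact_integrable; first exact: segment_compact.
exact: continuous_subspaceT.
Qed.

Lemma Rintegral_deriv (G : {poly R}) (a b : R) : a < b ->
  \int[mu]_(u in `[a, b]) G^`().[u] = G.[b] - G.[a].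
Proof.
move=> ab; rewrite /Rintegral (@continuous_FTC2 _ _ (horner G)) //.
- by apply: continuous_subspaceT; apply: continuous_horner.
- split=> [x _||].
  + by have := is_derive_poly G x; case.
  + by apply: cvg_at_right_filter; apply: continuous_horner.
  + by apply: cvg_at_left_filter; apply: continuous_horner.
- by move=> x _; rewrite derive1E; have := is_derive_poly G x; case.
Qed.

Lemma Rintegral_poly_approx (h : R -> R) (G : {poly R}) (eps a b : R) :
  continuous h -> a <= b ->
  (forall u, a <= u <= b -> `|h u - G^`().[u]| <= eps) ->
  `|\int[mu]_(u in `[a, b]) h u - (G.[b] - G.[a])| <= eps * (b - a).
Proof.
move=> ch; rewrite le_eqVlt => /predU1P[<- _|ab hG].
  by rewrite set_itv1 Rintegral_set1 !subrr mulr0 normr0.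
have cG := @continuous_horner R G^`().
rewrite -(Rintegral_deriv G ab) -RintegralB//; last 2 first.
- exact: continuous_integrable_itv.
- exact: continuous_integrable_itv.
have cD : continuous (fun u => h u - G^`().[u]).
  by move=> u; apply: cvgB; [exact: ch|exact: cG].
apply: le_trans (le_normr_Rintegral _ _) _ => //.
  exact: continuous_integrable_itv.
(* The bound is itself the integral of the constant eps, the derivative of eps X, so two integrals
   can be compared. *)
have -> : eps * (b - a) =
    \int[mu]_(u in `[a, b]) (eps *: 'X : {poly R})^`().[u].
  by rewrite (Rintegral_deriv _ ab) !hornerZ !hornerX mulrBr.
apply: le_Rintegral => //.
- apply: continuous_integrable_itv => u; apply: cvg_norm; exact: cD.
- by apply: continuous_integrable_itv; apply: continuous_horner.
- move=> u; rewrite /= in_itv /= => hu.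
  rewrite derivZ derivX hornerZ hornerC mulr1; exact: hG.
Qed.

(** The interval between 0 and x has length at most 1, so integration does not enlarge the error;
    for x < 0 both orientations flip sign. *)
Lemma oriented_int_approx (h : R -> R) (G : {poly R}) (eps x : R) :
  continuous h -> G.[0] = 0 ->
  (forall u, -1 <= u <= 1 -> `|h u - G^`().[u]| <= eps) ->
  -1 <= x <= 1 -> `|oriented_int 0 x h - G.[x]| <= eps.
Proof.
move=> ch G0 hG hx.
have e0 : 0 <= eps by apply: le_trans (hG 0 _) => //; lra.
rewrite /oriented_int; case: ifPn => [x0|]; last rewrite -ltNge => x0.
  have := @Rintegral_poly_approx h G eps 0 x ch x0.
  rewrite G0 subr0 => /(_ _)/le_trans; apply.
    by move=> u hu; apply: hG; lra.
  by rewrite subr0 ler_piMr//; lra.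
have := @Rintegral_poly_approx h G eps x 0 ch (ltW x0).
rewrite G0 !sub0r opprK -normrN opprD => /(_ _)/le_trans; apply.
  by move=> u hu; apply: hG; lra.
by rewrite ler_piMr//; lra.
Qed.

End PolynomialIntegral.

(** * Approximation of the four function classes *)

Section ClassApproximation.
Variable R : realType.
Notation T := (@chebT R).

(** Of the exponent (17 + 16 c) L, the part 16 L cancels [E], 16 c L absorbs the factor 16 c, and L
    leaves e^(-L). The 8 is the prefactor in [erf_approx], the largest one. *)
Lemma error_le (L c E t : R) : 1 <= L -> 1 <= c -> E <= expR (16 * L) ->
  (17 + 16 * c) * L <= t -> 8 * E * expR (- t) <= expR (- L) / (2 * c).
Proof.
move=> L1 c1 hE ht; have c0 : 0 < c by lra.
rewrite ler_pdivlMr ?mulr_gt0//.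
have h1 : 8 * (2 * c) <= expR (16 * c * L).
  apply: le_trans (expR_ge1Dx _).
  have : c <= c * L by rewrite ler_peMr// ltW.
  by nra.
have h2 : E * expR (- t) <= expR (16 * L) * expR (- ((17 + 16 * c) * L)).
  apply: le_trans (ler_wpM2r (expR_ge0 _) hE) _.
  by rewrite ler_wpM2l ?expR_ge0// ler_expR lerN2.
have h3 : 8 * (2 * c) * (expR (16 * L) * expR (- ((17 + 16 * c) * L))) <=
    expR (16 * c * L) * (expR (16 * L) * expR (- ((17 + 16 * c) * L))).
  by rewrite ler_wpM2r// mulr_ge0 ?expR_ge0.
have <- : expR (16 * c * L) * (expR (16 * L) * expR (- ((17 + 16 * c) * L))) =
    expR (- L) by rewrite -!expRD; congr expR; ring.
apply: le_trans h3.
have -> : 8 * E * expR (- t) * (2 * c) = 8 * (2 * c) * (E * expR (- t)) by ring.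
by rewrite ler_wpM2l//; lra.
Qed.

(** Take s = sqrt (L / D), at most 1 because L <= D, and d just above k sqrt (D L). Rounding up
    costs at most the factor 2, as k sqrt (D L) >= 1. The bound sqrt D <= d serves the prefactor of
    erf. *)
Lemma truncation_window (k L D : R) : 1 <= k -> 1 <= L -> L <= D ->
  exists (s : R) (d : nat), [/\ 0 <= s <= 1, D * s ^+ 2 = L,
    k * L <= s * d%:R, Num.sqrt D <= d%:R & d%:R <= 2 * k * Num.sqrt (D * L)].
Proof.
move=> k1 L1 LD; have D1 : 1 <= D by lra.
have q1 : 1 <= Num.sqrt (D * L).
  by rewrite -[X in X <= _]sqrtr1 ler_wsqrtr//; nra.
pose d := (Num.truncn (k * Num.sqrt (D * L))).+1.
have hd : k * Num.sqrt (D * L) <= d%:R by rewrite ltW// truncnS_gt.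
have LD0 : 0 <= L / D by apply: divr_ge0; lra.
exists (Num.sqrt (L / D)), d; split.
- rewrite sqrtr_ge0 -[X in _ <= X]sqrtr1 ler_wsqrtr//.
  by rewrite ler_pdivrMr ?mul1r//; lra.
- by rewrite sqr_sqrtr//; field; lra.
- apply: le_trans (ler_wpM2l (sqrtr_ge0 _) hd); rewrite mulrCA -sqrtrM//.
  have -> : L / D * (D * L) = L ^+ 2 by field; lra.
  by rewrite sqrtr_sqr ger0_norm; lra.
- apply: le_trans hd; have h : Num.sqrt D <= Num.sqrt (D * L).
    by rewrite ler_wsqrtr//; nra.
  by apply: le_trans h _; rewrite ler_peMl ?sqrtr_ge0.
- have h : (Num.truncn (k * Num.sqrt (D * L)))%:R <= k * Num.sqrt (D * L).
    by rewrite truncn_le mulr_ge0 ?sqrtr_ge0//; lra.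
  by rewrite /d -addn1 natrD; nra.
Qed.

(** Here x = T_1(x), and cosh s <= 1 + 8 s^2 <= e^(8 s^2) bounds the weighted norm (cosh s)^n. *)
Lemma monomial_approx (s : R) (n d : nat) : 0 <= s <= 1 ->
  exists2 p : {poly R}, (size p <= d.+1)%N &
    forall x, -1 <= x <= 1 -> `|x ^+ n - p.[x]| <=
      2 * expR (8 * (n%:R * s ^+ 2)) * expR (- (s * d%:R)).
Proof.
move=> /andP[s0 s1].
have hb : cheb_bounded s (fun x => (T 1).[x] ^+ n) (expR (8 * (n%:R * s ^+ 2))).
  apply: cheb_boundedW (cheb_boundedX s 1 n).
  rewrite mulr1 mulrCA expRM_natl lerXn2r ?nnegrE ?cosh_ge0 ?expR_ge0//.
  by apply: le_trans (expR_ge1Dx _); rewrite -lerBlDl cosh_le//; lra.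
have [p sp hp] := cheb_truncation d s0 hb.
exists p => // x hx; apply: le_trans (hp x hx).
by rewrite /chebT cheb_rec1 hornerX.
Qed.

(* The untruncated expansion is kept, because the error function integrates it
   before truncating. *)
Lemma exponential_expansion (s b eps : R) m : (0 < m <= 2)%N -> 0 <= s <= 1 ->
  0 <= b -> 0 < eps ->
  exists2 r, cheb_weight s r <= expR (8 * m%:R ^+ 2 * (b * s ^+ 2)) &
    forall x, -1 <= x <= 1 ->
      `|expR (- b * (1 + (T m).[x])) - cheb_sum r x| <= eps.
Proof.
move=> /andP[m0 m2] /andP[s0 s1] b0 e0.
have [h [r er br] eh] := cheb_bounded_exp s m b0 e0.
exists r => [|x hx]; last by rewrite -er// eh.
apply: le_trans br _; rewrite ler_expR mulrCA ler_wpM2l//.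
have -> : 8 * m%:R ^+ 2 * s ^+ 2 = 8 * (s * m%:R) ^+ 2 by rewrite exprMn; ring.
rewrite cosh_le// mulr_ge0//=.
have : m%:R <= 2 :> R by rewrite ler_nat.
by move=> m2'; rewrite (le_trans (ler_wpM2l s0 m2'))//; lra.
Qed.

Lemma exponential_approx (s b eps : R) m d : (0 < m <= 2)%N -> 0 <= s <= 1 ->
  0 <= b -> 0 < eps ->
  exists2 p : {poly R}, (size p <= d.+1)%N &
    forall x, -1 <= x <= 1 -> `|expR (- b * (1 + (T m).[x])) - p.[x]| <=
      2 * expR (8 * m%:R ^+ 2 * (b * s ^+ 2)) * expR (- (s * d%:R)) + eps.
Proof.
move=> hm hs b0 e0; have [r br er] := exponential_expansion hm hs b0 e0.
have s0 : 0 <= s by case/andP: hs.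
have hb : cheb_bounded s (cheb_sum r) (expR (8 * m%:R ^+ 2 * (b * s ^+ 2))).
  by exists r.
have [p sp hp] := cheb_truncation d s0 hb.
exists p => // x hx; rewrite [leRHS]addrC.
apply: le_trans (ler_distD (cheb_sum r x) _ _) _.
by apply: lerD; [exact: er|exact: hp].
Qed.

Lemma gaussianE (gamma x : R) :
  gaussian_fun gamma x = expR (- (gamma ^+ 2 / 2) * (1 + (T 2).[x])).
Proof. by rewrite /gaussian_fun chebT2; congr expR; field. Qed.

(** The Gaussian integrand is expanded, integrated term by term, and cut at index d. Dropped
    primitives are at most 2/d, which cancels the prefactor q <= 2 d up to a factor 4. Integration
    raises the degree to d + 1. *)
Lemma erf_approx (s lambda eps : R) d : (0 < d)%N -> 0 <= s <= 1 ->
  0 < lambda -> lambda <= d%:R -> 0 < eps ->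
  exists2 p : {poly R}, (size p <= d.+2)%N &
    forall x, -1 <= x <= 1 -> `|erf_fun lambda x - p.[x]| <=
      8 * expR (16 * (lambda ^+ 2 * s ^+ 2)) * expR (- (s * d%:R)) + eps.
Proof.
move=> d0 hs l0 ld e0; have s0 : 0 <= s by case/andP: hs.
have pi1 : 1 <= Num.sqrt pi :> R.
  by rewrite -[X in X <= _]sqrtr1 ler_wsqrtr//; have := pi_ge2 R; lra.
set q := 2 * lambda / Num.sqrt pi.
have q0 : 0 < q by rewrite divr_gt0 ?mulr_gt0//; lra.
have qd : q <= 2 * d%:R.
  by rewrite ler_pdivrMr; [nra|lra].
have b0 : 0 <= lambda ^+ 2 / 2 by rewrite divr_ge0 ?sqr_ge0.
(* Accuracy eps / q compensates the prefactor q in front of the integral. *)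
have [r br er] :=
  exponential_expansion (isT : 0 < 2 <= 2)%N hs b0 (divr_gt0 e0 q0).
have [A hA] := boolp.choice (@chebT_primitive R).
exists (q *: \sum_(u <- r | (u.2 <= d)%N) u.1 *: A u.2).
  apply: leq_trans (size_scale_leq _ _) _.
  apply: leq_trans (size_sum _ _ _) _; rewrite big_tnth.
  apply/bigmax_leqP => i; move: (tnth _ _) => u ud.
  rewrite (leq_trans (size_scale_leq _ _))//.
  by have [_ _ h _] := hA u.2; apply: leq_trans h _.
move=> x hx; pose G := \sum_(u <- r) u.1 *: A u.2.
have G0 : G.[0] = 0.
  rewrite /G horner_sum big1// => u _; rewrite hornerZ.
  by have [_ -> _ _] := hA u.2; rewrite mulr0.
have dG u : G^`().[u] = cheb_sum r u.
  rewrite /G raddf_sum horner_sum; apply: eq_bigr => v _ /=.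
  by rewrite derivZ hornerZ; have [-> _ _ _] := hA v.2.
have cg : continuous (fun u => expR (- (lambda * u) ^+ 2)).
  move=> u; apply: continuous_comp; last exact: continuous_expR.
  apply: cvgN.
  apply: (@continuous_comp _ _ _ (fun u => lambda * u) (fun y => y ^+ 2)).
    exact: mulrl_continuous.
  exact: exprn_continuous.
have h1 : `|erf_fun lambda x - q * G.[x]| <= eps.
  rewrite /erf_fun -/q -mulrBr normrM (gtr0_norm q0) mulrC -ler_pdivlMr//.
  apply: oriented_int_approx => // u hu; rewrite dG -/(gaussian_fun lambda u).
  by rewrite gaussianE; apply: er.
have h2 : `|q * G.[x] - (q *: \sum_(u <- r | (u.2 <= d)%N) u.1 *: A u.2).[x]| <=
   8 * expR (16 * (lambda ^+ 2 * s ^+ 2)) * expR (- (s * d%:R)).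
  rewrite hornerZ -mulrBr normrM (gtr0_norm q0).
  rewrite /G (bigID (fun u => (u.2 <= d)%N))/= hornerD addrAC subrr add0r.
  rewrite horner_sum.
  have h : `|\sum_(u <- r | ~~ (u.2 <= d)%N) (u.1 *: A u.2).[x]| <=
      2 / d%:R * \sum_(u <- r | (d < u.2)%N) `|u.1|.
    apply: le_trans (ler_norm_sum _ _ _) _; rewrite mulr_sumr.
    under eq_bigl do rewrite -ltnNge.
    apply: ler_sum => u du; rewrite hornerZ normrM mulrC ler_wpM2r//.
    by have [_ _ _ hA'] := hA u.2; apply: hA' => //; rewrite d0.
  apply: le_trans (ler_pM (ltW q0) (normr_ge0 _) qd h) _.
  have -> : forall z : R, 2 * d%:R * (2 / d%:R * z) = 4 * z.
    by move=> z; field; rewrite pnatr_eq0 -lt0n.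
  have ht := cheb_tail d r s0.
  have hw : 2 * cheb_weight s r * expR (- (s * d%:R)) <=
     2 * expR (16 * (lambda ^+ 2 * s ^+ 2)) * expR (- (s * d%:R)).
    rewrite ler_wpM2r ?expR_ge0// ler_wpM2l//; apply: le_trans br _.
    by rewrite ler_expR le_eqVlt; apply/orP; left; apply/eqP; field.
  by lra.
rewrite [leRHS]addrC; apply: le_trans (ler_distD (q * G.[x]) _ _) _.
by apply: lerD.
Qed.

Lemma is_deg_approx (c L D : R) (f : R -> R) : 1 <= c -> 1 <= L ->
  is_deg (expR (- L)) f D ->
  exists2 p : {poly R},
    (size p).-1%:R <= 4 * (17 + 16 * c) * Num.sqrt (D * L) &
    forall x, -1 <= x <= 1 -> `|f x - p.[x]| <= expR (- L) / c.
Proof.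
move=> c1 L1; have c0 : 0 < c by lra.
set k := 17 + 16 * c; have k1 : 1 <= k by rewrite /k; lra.
(* Half of the tolerance is kept for the Maclaurin error, half for the truncation. *)
have e0 : 0 < expR (- L) / (2 * c) by rewrite divr_gt0 ?expR_gt0 ?mulr_gt0.
have e2 : expR (- L) / (2 * c) + expR (- L) / (2 * c) = expR (- L) / c.
  by field; lra.
have eL : ln (1 / expR (- L)) = L by rewrite expRN div1r invrK expRK.
rewrite /is_deg eL.
(* The slack d + 2 admits the degree d + 1 of the erf case; d + 1 <= 2 d turns 2 k into 4 k. *)
have size_le (p : {poly R}) (d : nat) D' : (0 < d)%N -> (size p <= d.+2)%N ->
    d%:R <= 2 * k * Num.sqrt (D' * L) ->
    (size p).-1%:R <= 4 * k * Num.sqrt (D' * L).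
  move=> d0 sp hd; have : (size p).-1%:R <= (d + d)%:R :> R.
    by rewrite ler_nat; case: (size p) sp => //= n; rewrite !ltnS; lia.
  by rewrite natrD; lra.
have d_gt0 (s : R) d : k * L <= s * d%:R -> (0 < d)%N.
  case: d => //; rewrite mulr0 => kL; suff : 0 < k * L by rewrite ltNge kL.
  by apply: mulr_gt0; lra.
case.
- move=> [n fn ->].
  (* Only a monomial can have degree below L, where [truncation_window] does not apply; but then n
     <= sqrt (n L) and x^n approximates itself. *)
  have [nL|Ln] := lerP n%:R L.
    exists 'X^n => [|x hx]; last first.
      by rewrite fn// /mon_fun hornerXn subrr normr0 divr_ge0 ?expR_ge0// ltW.
    rewrite size_polyXn /=.
    have h : n%:R <= Num.sqrt (n%:R * L).
      rewrite -[X in X <= _]ger0_norm// -sqrtr_sqr ler_wsqrtr//.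
      by rewrite expr2 ler_wpM2l.
    apply: le_trans h _; rewrite ler_peMl ?sqrtr_ge0//; lra.
  have [s [d [hs Ds kd qd dq]]] := truncation_window k1 L1 (ltW Ln).
  have [p sp hp] := monomial_approx n d hs.
  exists p.
    by apply: size_le dq; rewrite ?(d_gt0 _ _ kd)// (leq_trans sp).
  move=> x hx; rewrite fn//; apply: le_trans (hp x hx) _; rewrite Ds.
  have hE : expR (8 * L) <= expR (16 * L) by rewrite ler_expR; lra.
  have := error_le L1 c1 hE kd.
  have : 0 < expR (8 * L) * expR (- (s * d%:R)) by rewrite mulr_gt0 ?expR_gt0.
  by lra.
- move=> [b [b0 fb ->]].
  have LD : L <= b + L by lra.
  have [s [d [hs Ds kd qd dq]]] := truncation_window k1 L1 LD.
  have [p sp hp] := exponential_approx d (isT : 0 < 1 <= 2)%N hs (ltW b0) e0.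
  exists p.
    by apply: size_le dq; rewrite ?(d_gt0 _ _ kd)// (leq_trans sp).
  move=> x hx; rewrite fb// /exp_fun.
  have := hp x hx; rewrite {1}/chebT cheb_rec1 hornerX => /le_trans; apply.
  have hE : expR (8 * 1%:R ^+ 2 * (b * s ^+ 2)) <= expR (16 * L).
    by rewrite ler_expR; have := sqr_ge0 s; nra.
  have := error_le L1 c1 hE kd.
  have : 0 < expR (8 * 1%:R ^+ 2 * (b * s ^+ 2)) * expR (- (s * d%:R)).
    by rewrite mulr_gt0 ?expR_gt0.
  by lra.
- move=> [g [g0 fg ->]].
  have LD : L <= g ^+ 2 + L by have := sqr_ge0 g; lra.
  have [s [d [hs Ds kd qd dq]]] := truncation_window k1 L1 LD.
  have b0 : 0 <= g ^+ 2 / 2 by rewrite divr_ge0 ?sqr_ge0.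
  have [p sp hp] := exponential_approx d (isT : 0 < 2 <= 2)%N hs b0 e0.
  exists p.
    by apply: size_le dq; rewrite ?(d_gt0 _ _ kd)// (leq_trans sp).
  move=> x hx; rewrite fg// gaussianE; apply: le_trans (hp x hx) _.
  (* The exponent is 16 g^2 s^2, and g^2 s^2 <= D s^2 = L: hence the 16 in [error_le]. *)
  have hE : expR (8 * 2%:R ^+ 2 * (g ^+ 2 / 2 * s ^+ 2)) <= expR (16 * L).
    by rewrite ler_expR; have := sqr_ge0 s; nra.
  have := error_le L1 c1 hE kd.
  have : 0 < expR (8 * 2%:R ^+ 2 * (g ^+ 2 / 2 * s ^+ 2)) * expR (- (s * d%:R)).
    by rewrite mulr_gt0 ?expR_gt0.
  by lra.
- move=> [l [l0 fl ->]].
  have LD : L <= l ^+ 2 + L by have := sqr_ge0 l; lra.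
  have [s [d [hs Ds kd qd dq]]] := truncation_window k1 L1 LD.
  have ld : l <= d%:R.
    apply: le_trans qd; rewrite -[X in X <= _]ger0_norm ?(ltW l0)// -sqrtr_sqr.
    by rewrite ler_wsqrtr//; lra.
  have [p sp hp] := erf_approx (d_gt0 _ _ kd) hs l0 ld e0.
  exists p; first by apply: size_le dq; rewrite ?(d_gt0 _ _ kd).
  move=> x hx; rewrite fl//; apply: le_trans (hp x hx) _.
  have hE : expR (16 * (l ^+ 2 * s ^+ 2)) <= expR (16 * L).
    by rewrite ler_expR; have := sqr_ge0 s; nra.
  by have := error_le L1 c1 hE kd; lra.
Qed.

End ClassApproximation.

(** * From polynomials in cos y or sin y to Laurent polynomials *)

Section Laurent.
Variable R : realType.

Lemma norm_expi (y : R) : `|expi y| = 1.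
Proof. by rewrite normc_def /= cos2Dsin2 sqrtr1. Qed.

Lemma expi_neq0 (y : R) : expi y != 0.
Proof. by rewrite -normr_eq0 norm_expi oner_eq0. Qed.

Lemma norm_real_complex (r : R) : `|r%:C| = `|r|%:C.
Proof. by rewrite normc_def /= expr0n addr0 sqrtr_sqr. Qed.

(** The formula cos y = (z + 1/z) / 2 with its denominator cleared, as [horner_clear_denominators]
    expects. *)
Lemma cos_expi (y : R) :
  (cos y)%:C * expi y = ((2^-1)%:C *: ('X^2 + 1)).[expi y].
Proof.
rewrite !hornerE /expi; apply/eqP; rewrite eq_complex /=.
apply/andP; split; apply/eqP.
  by have := cos2Dsin2 y; lra.
by lra.
Qed.

Lemma sin_expi (y : R) :
  (sin y)%:C * expi y = ((0 -i* (2^-1)) *: ('X^2 - 1)).[expi y].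
Proof.
rewrite !hornerE /expi; apply/eqP; rewrite eq_complex /=.
apply/andP; split; apply/eqP.
  by lra.
by have := cos2Dsin2 y; lra.
Qed.

(* Multiplying by z^l clears the denominators: if u z = A(z) then
   z^l P(u) = sum_j p_j z^(l-j) A(z)^j. *)
Lemma horner_clear_denominators (P : {poly R}) (A : {poly R[i]}) (l : nat) :
  (size P <= l.+1)%N -> (size A <= 3)%N ->
  exists2 Q : {poly R[i]}, (size Q <= l.*2.+1)%N &
    forall (u : R) z, u%:C * z = A.[z] -> (P.[u])%:C * z ^+ l = Q.[z].
Proof.
move=> sP sA.
exists (\sum_(j < size P) (P`_j)%:C *: ('X^(l - j) * A ^+ j)).
  apply: leq_trans (size_sum _ _ _) _; apply/bigmax_leqP => j _.
  apply: leq_trans (size_scale_leq _ _) _.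
  apply: leq_trans (size_polyMleq _ _) _; rewrite size_polyXn.
  have h1 := size_poly_exp_leq A j.
  have h2 : ((size A).-1 * j <= 2 * j)%N.
    by rewrite leq_mul2r; apply/orP; right; move: sA; case: (size A).
  have jl : (j <= l)%N by rewrite -ltnS (leq_trans (ltn_ord j)).
  move: h1 h2; move: (size (A ^+ j)) ((size A).-1 * j)%N => a b h1 h2.
  by rewrite -muln2; lia.
move=> u z uz; rewrite horner_coef rmorph_sum mulr_suml horner_sum.
apply: eq_bigr => j _; rewrite hornerZ hornerM hornerXn horner_exp -uz.
have jl : (j <= l)%N by rewrite -ltnS (leq_trans (ltn_ord j)).
rewrite rmorphM rmorphXn -mulrA; congr (_ * _).
by rewrite exprMn mulrCA -exprD subnK.
Qed.

(** Dividing by z^l shifts indices by l; [absz] is harmless because k + l >= 0 for every k in the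
    sum. *)
Lemma laurent_eval_poly (Q : {poly R[i]}) (l : nat) (z : R[i]) :
  (size Q <= l.*2.+1)%N -> z != 0 ->
  laurent_eval l (fun k : int => Q`_(absz (k + l%:Z))) z = Q.[z] / z ^+ l.
Proof.
move=> sQ z0; rewrite (horner_coef_wide _ sQ) mulr_suml /laurent_eval.
apply: eq_bigr => k _; rewrite subrK absz_nat -mulrA; congr (_ * _).
by rewrite expfzDr// exprnP exprnN.
Qed.

(* Extreme coefficients that happen to vanish are replaced by [eta], so that
   the degree is exactly [l]. *)
Lemma laurent_exact_degree (Q : {poly R[i]}) (l : nat) (eta : R) :
  0 < eta -> (size Q <= l.*2.+1)%N ->
  exists Q' : {poly R[i]},
    [/\ (size Q' <= l.*2.+1)%N, l = 0%N \/ (Q'`_(l.*2) != 0 /\ Q'`_0 != 0) &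
      forall z, `|z| = 1 -> `|Q'.[z] - Q.[z]| <= (eta + eta)%:C].
Proof.
(* For l = 0 both extreme coefficients are the same one, and a constant needs no correction. *)
move=> e0 sQ; case: (posnP l) => [->|l0] in sQ *.
  exists Q; split=> //; first by left.
  by move=> z _; rewrite subrr normr0 lecR; lra.
have eC : eta%:C != 0 by rewrite eq_complex /= eqxx andbT gt_eqF.
pose t (x : R[i]) := if x == 0 then eta%:C else 0.
have tx x : x + t x != 0.
  by rewrite /t; case: (eqVneq x 0) => [->|]; rewrite ?add0r ?addr0.
have nt x : `|t x| <= eta%:C.
  rewrite /t; case: ifP => _; rewrite ?normr0 ?norm_real_complex ?gtr0_norm//.
  by rewrite lecR ltW.
exists (Q + ((t Q`_0)%:P + t Q`_(l.*2) *: 'X^(l.*2))); split.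
- apply: leq_trans (size_polyD _ _) _; rewrite geq_max sQ.
  apply: leq_trans (size_polyD _ _) _; rewrite geq_max.
  rewrite (leq_trans (size_polyC_leq1 _))//.
  by rewrite (leq_trans (size_scale_leq _ _))// size_polyXn.
- right; rewrite !coefD !coefC !coefZ !coefXn eqxx.
  have l2 : (l.*2 == 0)%N = false by rewrite double_eq0 gtn_eqF.
  by rewrite l2 [(0 == l.*2)%N]eq_sym l2 mulr0 mulr1 add0r addr0 !tx.
- move=> z z1; rewrite hornerD addrAC subrr add0r !hornerE.
  apply: le_trans (ler_normD _ _) _; rewrite rmorphD lerD// normrM normrX z1.
  by rewrite expr1n mulr1.
Qed.

End Laurent.

(** * Assembling the linear combination *)

Lemma sum_approx (R : realType) (N : nat) (a u v : 'I_N -> R) (e : R) :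
  (forall i, `|u i - v i| <= e) ->
  `|\sum_(i < N) a i * u i - \sum_(i < N) a i * v i| <=
    (\sum_(i < N) `|a i|) * e.
Proof.
move=> huv; rewrite -sumrB mulr_suml; apply: le_trans (ler_norm_sum _ _ _) _.
by apply: ler_sum => i _; rewrite -mulrBr normrM ler_wpM2l.
Qed.

(** The exponent l is given in advance and can be shared by all terms, so that their numerators over
    z^l can be added; a degree below l + 1 is at most l. *)
Lemma laurent_rep_approx (R : realType) (c L D : R) (g : R -> R) (l : nat) :
  1 <= c -> 1 <= L -> is_laurent_rep_deg (expR (- L)) g D ->
  4 * (17 + 16 * c) * Num.sqrt (D * L) < l.+1%:R ->
  exists (v : R -> R) (Q : {poly R[i]}), [/\ (size Q <= l.*2.+1)%N,
    forall y, `|g y - v y| <= expR (- L) / c &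
    forall y, (v y)%:C * expi y ^+ l = Q.[expi y]].
Proof.
move=> c1 L1 [f fD gE] hl; have [p sp hp] := is_deg_approx c1 L1 fD.
have sP : (size p <= l.+1)%N.
  have := le_lt_trans sp hl; rewrite ltr_nat; by case: (size p).
case: gE => ->.
- have sA : (size ((2^-1)%:C *: ('X^2 + 1) : {poly R[i]})%R <= 3)%N.
    rewrite (leq_trans (size_scale_leq _ _))//.
    by rewrite (leq_trans (size_polyD _ _))// size_polyXn size_poly1.
  have [Q sQ hQ] := horner_clear_denominators sP sA.
  exists (fun y => p.[cos y]), Q; split=> // y.
    by apply: hp; rewrite cos_geN1 cos_le1.
  by apply: hQ; apply: cos_expi.
- have sA : (size ((0 -i* 2^-1) *: ('X^2 - 1) : {poly R[i]})%R <= 3)%N.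
    rewrite (leq_trans (size_scale_leq _ _))//.
    by rewrite (leq_trans (size_polyD _ _))// size_polyN size_polyXn size_poly1.
  have [Q sQ hQ] := horner_clear_denominators sP sA.
  exists (fun y => p.[sin y]), Q; split=> // y.
    by apply: hp; rewrite sin_geN1 sin_le1.
  by apply: hQ; apply: sin_expi.
Qed.

Theorem theorem1 (R : realType) :
  exists delta0 : R, 0 < delta0 <= 1 / 2 /\
  forall (N M : nat) (C : R),
  exists K : R, 0 < K /\
  forall (f : 'I_N -> R -> R) (g : 'I_M -> R -> R)
    (a : 'I_N -> R) (b : 'I_M -> R) (F : R -> R -> R),
  (forall i, F_all (f i)) ->
  (forall j, G_all (g j)) ->
  (forall x y : R, -1 <= x <= 1 ->
     F x y = \sum_(i < N) a i * f i x + \sum_(j < M) b j * g j y) ->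
  \sum_(i < N) `|a i| + \sum_(j < M) `|b j| = C ->
  forall delta : R, 0 < delta <= delta0 ->
  forall (degf : 'I_N -> R) (degh : 'I_M -> R),
  (forall i, is_deg delta (f i) (degf i)) ->
  (forall j, is_laurent_rep_deg delta (g j) (degh j)) ->
  let nl := \big[Num.max/0]_(i < N) degf i in
  let ml := \big[Num.max/0]_(j < M) degh j in
  exists (P : {poly R}) (l : nat) (c : int -> R[i]),
    [/\ (size P).-1%:R <= K * Num.sqrt (nl * ln (1 / delta)),
        laurent_degree l c,
        l%:R <= K * Num.sqrt (ml * ln (1 / delta))
      & forall x y : R, -1 <= x <= 1 ->
          `| (F x y)%:C - ((P.[x])%:C + laurent_eval l c (expi y)) |
            <= delta%:C].
Proof.
(* This threshold is exactly L >= 1, and e >= 2 puts it below 1/2. *)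
exists (expR (- 1)); split.
  rewrite expR_gt0 /= expRN div1r lef_pV2 ?posrE ?expR_gt0//.
  by apply: le_trans (expR_ge1Dx _); lra.
(* Accuracy delta / c per term gives a total error C delta / c <= delta / 2; the added 1 ensures c
   >= 1. *)
move=> N M C; pose c := 2 * (`|C| + 1).
have c1 : 1 <= c by rewrite /c; have := normr_ge0 C; lra.
pose K := 4 * (17 + 16 * c); have K0 : 0 < K by rewrite /K; lra.
exists K; split=> // f g a b F _ _ FE aC delta /andP[d0 d1] degf degh hf hg.
move=> nl ml.
set L := ln (1 / delta).
have dL : delta = expR (- L) by rewrite /L div1r lnV ?posrE// opprK lnK.
have L1 : 1 <= L by rewrite -lerN2 -ler_expR -dL.
have mono D D' : D <= D' -> K * Num.sqrt (D * L) <= K * Num.sqrt (D' * L).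
  by move=> DD; rewrite ler_pM2l// ler_wsqrtr// ler_wpM2r//; lra.
have Ks0 D : 0 <= K * Num.sqrt (D * L) by rewrite mulr_ge0 ?sqrtr_ge0 ?ltW.
have /boolp.choice[p hp] i : exists q : {poly R},
    (size q).-1%:R <= K * Num.sqrt (nl * L) /\
    forall x, -1 <= x <= 1 -> `|f i x - q.[x]| <= delta / c.
  have hfi := hf i; rewrite dL in hfi *.
  have [q sq hq] := is_deg_approx c1 L1 hfi.
  exists q; split=> //; apply: le_trans sq _; apply: mono; exact: le_bigmax.
(* The largest degree the bound allows; it depends on the maximum [ml] only, hence is common to all
   j. *)
pose l := Num.truncn (K * Num.sqrt (ml * L)).
have /boolp.choice[v hv] j : exists w : (R -> R) * {poly R[i]},
    [/\ (size w.2 <= l.*2.+1)%N,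
      forall y, `|g j y - w.1 y| <= delta / c &
      forall y, (w.1 y)%:C * expi y ^+ l = w.2.[expi y]].
  have hgj := hg j; rewrite dL in hgj *.
  have hl : K * Num.sqrt (degh j * L) < l.+1%:R.
    by apply: le_lt_trans (truncnS_gt _); apply: mono; exact: le_bigmax.
  have [w [Q [sQ h1 h2]]] := laurent_rep_approx c1 L1 hgj hl.
  by exists (w, Q).
pose P := \sum_(i < N) a i *: p i.
pose Q := \sum_(j < M) (b j)%:C *: (v j).2.
have sQ : (size Q <= l.*2.+1)%N.
  apply: leq_trans (size_sum _ _ _) _; apply/bigmax_leqP => j _.
  by apply: leq_trans (size_scale_leq _ _) _; have [] := hv j.
(* Two altered extreme coefficients cost delta / 4 each, the half of the tolerance left by the
   approximation of the terms. *)
have e0 : 0 < delta / 4 by rewrite divr_gt0.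
have [Q' [sQ' Q'l Q'Q]] := laurent_exact_degree e0 sQ.
exists P, l, (fun k : int => Q'`_(absz (k + l%:Z))); split.
- pose n := Num.truncn (K * Num.sqrt (nl * L)).
  suff sP : (size P <= n.+1)%N.
    have : (size P).-1%:R <= n%:R :> R by rewrite ler_nat; case: (size P) sP.
    by move=> /le_trans; apply; rewrite truncn_le.
  apply: leq_trans (size_sum _ _ _) _; apply/bigmax_leqP => i _.
  apply: leq_trans (size_scale_leq _ _) _; have [sp _] := hp i.
  have : ((size (p i)).-1 <= n)%N by rewrite truncn_ge_nat.
  by case: (size _).
- case: Q'l => [->|[h1 h2]]; [by left|right].
  by rewrite -PoszD addnn addNr; split.
- by rewrite truncn_le.
move=> x y hx; rewrite laurent_eval_poly ?expi_neq0//.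
pose V := \sum_(j < M) b j * (v j).1 y.
have QV : Q.[expi y] / expi y ^+ l = V%:C.
  rewrite /Q horner_sum mulr_suml rmorph_sum; apply: eq_bigr => j _.
  have [_ _ h] := hv j; rewrite hornerZ -h rmorphM -mulrA mulfK//.
  by rewrite expf_neq0// expi_neq0.
have h1 : `|F x y - (P.[x] + V)| <= delta / 2.
  have -> : P.[x] = \sum_(i < N) a i * (p i).[x].
    by rewrite /P horner_sum; apply: eq_bigr => i _; rewrite hornerZ.
  rewrite FE// opprD addrACA; apply: le_trans (ler_normD _ _) _.
  have ha := @sum_approx R N a (f ^~ x) (fun i => (p i).[x]) (delta / c)
    (fun i => (hp i).2 x hx).
  have hb := @sum_approx R M b (g ^~ y) (fun j => (v j).1 y) (delta / c)
    (fun j => let: And3 _ h _ := hv j in h y).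
  apply: le_trans (lerD ha hb) _; rewrite -mulrDl aC.
  rewrite mulrA ler_pdivrMr; last by lra.
  have -> : delta / 2 * c = delta * (`|C| + 1) by rewrite /c; field.
  by rewrite mulrC ler_wpM2l ?ltW//; have := ler_norm C; lra.
(* The error splits into a real part from the terms and the change from Q to Q'; dividing the latter
   by z^l keeps its modulus, as |z| = 1. *)
have -> : (F x y)%:C - ((P.[x])%:C + Q'.[expi y] / expi y ^+ l) =
    (F x y - (P.[x] + V))%:C - (Q'.[expi y] - Q.[expi y]) / expi y ^+ l.
  by rewrite mulrBl QV !rmorphB rmorphD /=; ring.
apply: le_trans (ler_normB _ _) _.
have -> : delta%:C = (delta / 2)%:C + (delta / 2)%:C :> R[i].
  by rewrite -rmorphD /=; congr _%:C; field.
apply: lerD; first by rewrite norm_real_complex lecR.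
rewrite normrM normfV normrX norm_expi expr1n invr1 mulr1.
apply: le_trans (Q'Q _ (norm_expi y)) _.
by rewrite lecR; lra.
Qed.
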